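(* Let $\mathcal{W}',\hat{\mathcal{W}}'\in\mathbb{K}^{I_1\times\cdots\times I_\ell}$ have multilinear ranks $(R_1,\dots,R_\ell)$ and $(\hat{R}_1,\dots,\hat{R}_\ell)$ respectively. Fix $j$ and let $\mathbf{V}\in\mathbb{K}^{I_j\times R_j}$ have orthonormal columns whose range equals the span of the mode-$j$ fibers of $\mathcal{W}'$. If $\hat{R}_j\leq R_j$, then there is $\hat{\mathbf{V}}\in\mathbb{K}^{I_j\times R_j}$ with orthonormal columns whose range contains the span of the mode-$j$ fibers of $\hat{\mathcal{W}}'$, such that $$\|\mathcal{W}'\cdot_j\mathbf{V}^{\mathrm{H}}-\hat{\mathcal{W}}'\cdot_j\hat{\mathbf{V}}^{\mathrm{H}}\|_{\mathrm{F}}\leq\|\mathcal{W}'-\hat{\mathcal{W}}'\|_{\mathrm{F}}.$$ Consequently, with $R^*_i=\max\{R_i,\hat{R}_i\}$, there exist orthogonal compressions $\mathcal{W},\hat{\mathcal{W}}\in\mathbb{K}^{R^*_1\times\cdots\times R^*_\ell}$ of $\mathcal{W}'$ and $\hat{\mathcal{W}}'$ respectively with $\|\mathcal{W}-\hat{\mathcal{W}}\|_{\mathrm{F}}\leq\|\mathcal{W}'-\hat{\mathcal{W}}'\|_{\mathrm{F}}$.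
   Context: $\mathbb{K}$ denotes $\mathbb{R}$ or $\mathbb{C}$. Mode-$i$ fibers of an order-$\ell$ tensor are the vectors obtained by varying the $i$th index with the others fixed; the multilinear rank is $(R_1,\dots,R_\ell)$ with $R_i$ the dimension of the span of the mode-$i$ fibers. $\mathcal{X}\cdot_i\mathbf{M}$ applies the matrix $\mathbf{M}$ to every mode-$i$ fiber. Here an orthogonal compression of $\mathcal{X}\in\mathbb{K}^{I_1\times\cdots\times I_\ell}$ to size $R^*_1\times\cdots\times R^*_\ell$ means $\mathcal{X}\cdot_1\mathbf{V}_1^{\mathrm{H}}\cdots\cdot_\ell\mathbf{V}_\ell^{\mathrm{H}}$ where each $\mathbf{V}_i\in\mathbb{K}^{I_i\times R^*_i}$ has orthonormal columns whose range contains the span of the mode-$i$ fibers of $\mathcal{X}$. *)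

(* Defs.v *)
From HB Require Import structures.
From mathcomp Require Import all_boot all_order all_algebra.
Set Implicit Arguments. Unset Strict Implicit. Unset Printing Implicit Defensive.
Import Order.TTheory GRing.Theory Num.Theory.
Local Open Scope ring_scope.

Definition idx (l : nat) (I : 'I_l -> nat) : finType :=
  {dffun forall k : 'I_l, 'I_(I k)}.

Definition tensor (K : Type) (l : nat) (I : 'I_l -> nat) := idx I -> K.

Definition tsub (K : zmodType) l (I : 'I_l -> nat) (A B : tensor K I)
  : tensor K I := fun x => A x - B x.

Definition fnorm2 (K : numDomainType) l (I : 'I_l -> nat) (A : tensor K I) : K :=
  \sum_(x : idx I) `|A x| ^+ 2.

Definition setj l (I : 'I_l -> nat) (x : idx I) (j : 'I_l) (i : 'I_(I j))
  : idx I :=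
  @finfun _ (fun k => 'I_(I k)) (fun k =>
    match k =P j with
    | ReflectT e => cast_ord (congr1 I (esym e)) i
    | ReflectF _ => x k
    end).

(* Matrix whose rows are the mode-j fibers of A (each fiber listed once per
   multi-index through which it passes); its row space is the span of the
   mode-j fibers. *)
Definition fibers_mx (K : Type) l (I : 'I_l -> nat) (A : tensor K I) (j : 'I_l)
  : 'M[K]_(#|{: idx I}|, I j) :=
  \matrix_(x < #|{: idx I}|, i < I j) A (setj (enum_val x) i).

Definition mlrank (K : fieldType) l (I : 'I_l -> nat) (A : tensor K I) (j : 'I_l)
  : nat := \rank (fibers_mx A j).

Definition adjmx (K : Type) (conj : K -> K) m n (M : 'M[K]_(m, n)) : 'M[K]_(n, m) :=
  map_mx conj M^T.

Definition orthonormal_cols (K : pzRingType) (conj : K -> K) m n (V : 'M[K]_(m, n))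
  : Prop := adjmx conj V *m V = 1%:M.

Definition updim l (I : 'I_l -> nat) (j : 'I_l) (m : nat) : 'I_l -> nat :=
  fun k => if k == j then m else I k.

Lemma updim_j l (I : 'I_l -> nat) j m : updim I j m j = m.
Proof. by rewrite /updim eqxx. Qed.

Lemma updim_k l (I : 'I_l -> nat) j m k : k <> j -> updim I j m k = I k.
Proof. by move=> ne; rewrite /updim (introF eqP ne). Qed.

Definition back_idx l (I : 'I_l -> nat) (j : 'I_l) m (y : idx (updim I j m))
  (i : 'I_(I j)) : idx I :=
  @finfun _ (fun k => 'I_(I k)) (fun k =>
    match k =P j with
    | ReflectT e => cast_ord (congr1 I (esym e)) i
    | ReflectF ne => cast_ord (updim_k I m ne) (y k)
    end).

Definition modeprod (K : pzRingType) l (I : 'I_l -> nat) (A : tensor K I)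
  (j : 'I_l) m (M : 'M[K]_(m, I j)) : tensor K (updim I j m) :=
  fun y => \sum_(i < I j) M (cast_ord (updim_j I j m) (y j)) i * A (back_idx y i).

Definition mlprod (K : pzRingType) l (I J : 'I_l -> nat) (A : tensor K I)
  (Ms : forall k : 'I_l, 'M[K]_(J k, I k)) : tensor K J :=
  fun y => \sum_(x : idx I) (\prod_(k < l) Ms k (y k) (x k)) * A x.

Definition orth_compression (K : fieldType) (conj : K -> K) l (I : 'I_l -> nat)
  (A : tensor K I) (Rs : 'I_l -> nat) (Wc : tensor K Rs) : Prop :=
  exists Vs : forall k : 'I_l, 'M[K]_(I k, Rs k),
    (forall k, orthonormal_cols conj (Vs k) /\ (fibers_mx A k <= (Vs k)^T)%MS) /\
    (forall y, Wc y = mlprod A (fun k => adjmx conj (Vs k)) y).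

Definition Thm41 (K : numFieldType) (conj : K -> K) : Prop :=
  forall (l : nat) (I : 'I_l -> nat) (W Wh : tensor K I) (R Rh : 'I_l -> nat),
    (forall k, mlrank W k = R k) ->
    (forall k, mlrank Wh k = Rh k) ->
    (forall (j : 'I_l) (V : 'M[K]_(I j, R j)),
       orthonormal_cols conj V ->
       (V^T == fibers_mx W j)%MS ->
       (Rh j <= R j)%N ->
       exists Vh : 'M[K]_(I j, R j),
         [/\ orthonormal_cols conj Vh,
             (fibers_mx Wh j <= Vh^T)%MS &
             fnorm2 (tsub (modeprod W (adjmx conj V)) (modeprod Wh (adjmx conj Vh)))
               <= fnorm2 (tsub W Wh)])
    /\
    (exists Wc Whc : tensor K (fun k => maxn (R k) (Rh k)),
       [/\ orth_compression conj W Wc,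
           orth_compression conj Wh Whc &
           fnorm2 (tsub Wc Whc) <= fnorm2 (tsub W Wh)]).

(* Main.v *)
(* Given two families of vectors A and B with rank B <= rank A, some unitary T
   moves the span of B into that of A without increasing the distance between
   A and B; it is a product of reflections (see unitary_alignment). Projecting
   A and T B orthogonally onto the span of A does not increase it either, which
   gives the single-mode statement with Vh = T^H V.

   For the compression in all modes, the second tensor is aligned with the first one
   mode by mode (moving the first by T is the same as moving the second by T^H,
   so it does not matter which rank is larger). A unitary acting on
   one mode does not change the fiber spaces of the other modes, so eventually
   the two fiber spaces are nested in every mode, and both tensors are projected
   onto the larger one. *)
Require Import Defs.
From HB Require Import structures.
From mathcomp Require Import all_boot all_order all_algebra.
Set Implicit Arguments.
Unset Strict Implicit.
Unset Printing Implicit Defensive.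
Import Order.TTheory GRing.Theory Num.Theory.
Local Open Scope ring_scope.

(** * Multi-indices: changing one coordinate or one dimension, reindexing sums *)

Section Indices.
Variables (l : nat) (I : 'I_l -> nat).
Implicit Types (x : idx I) (j k : 'I_l).

Lemma setj_eq x j (i : 'I_(I j)) : setj x i j = i.
Proof.
rewrite /setj ffunE; case: eqP => // e.
by apply: val_inj.
Qed.

Lemma setj_neq x j (i : 'I_(I j)) k : k != j -> setj x i k = x k.
Proof. by rewrite /setj ffunE; case: eqP. Qed.

Lemma setj_setj x j (i i' : 'I_(I j)) : setj (setj x i) i' = setj x i'.
Proof.
apply/ffunP => k; have [->|nk] := eqVneq k j; first by rewrite !setj_eq.
by rewrite !setj_neq.
Qed.

Lemma setj_id x j : setj x (x j) = x.
Proof.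
apply/ffunP => k; have [->|nk] := eqVneq k j; first by rewrite !setj_eq.
by rewrite !setj_neq.
Qed.

Lemma setjC x j k (i : 'I_(I j)) (i' : 'I_(I k)) :
  k != j -> setj (setj x i) i' = setj (setj x i') i.
Proof.
move=> nkj; apply/ffunP => k'; have [->|nk] := eqVneq k' k.
  by rewrite setj_eq setj_neq // setj_eq.
rewrite setj_neq //; have [->|nj] := eqVneq k' j; first by rewrite !setj_eq.
by rewrite !setj_neq.
Qed.

(* Reindexing along the involution (x, i) |-> (setj x i, x j). *)
Lemma sum_setj (M : nmodType) j (F : idx I -> 'I_(I j) -> M) :
  \sum_x \sum_i F x i = \sum_x \sum_(i < I j) F (setj x i) (x j).
Proof.
rewrite !pair_big; pose h (p : idx I * 'I_(I j)) := (setj p.1 p.2, p.1 j).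
rewrite (reindex_inj (h := h)) //; apply: inv_inj => -[x i].
by rewrite /h /= setj_setj setj_id setj_eq.
Qed.

(** Inverse of [back_idx] once the overwritten coordinate is remembered: the pairs [(y, i)] with [y]
    in the resized index set correspond bijectively to the pairs [(x, r)] with [x : idx I] and
    [r : 'I_m]. *)
Definition fwd_idx j m x (r : 'I_m) : idx (updim I j m) :=
  @finfun _ (fun k => 'I_(updim I j m k)) (fun k =>
    match k =P j with
    | ReflectT e =>
        cast_ord (esym (etrans (congr1 (updim I j m) e) (updim_j I j m))) r
    | ReflectF ne => cast_ord (esym (updim_k I m ne)) (x k)
    end).

Lemma back_idx_eq j m (y : idx (updim I j m)) i : back_idx y i j = i.
Proof.
rewrite /back_idx ffunE; case: eqP => // e.
by apply: val_inj.
Qed.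

Lemma fwd_idx_eq j m x (r : 'I_m) :
  cast_ord (updim_j I j m) (fwd_idx j x r j) = r.
Proof. by rewrite /fwd_idx ffunE; case: eqP => // e; apply: val_inj. Qed.

Lemma setj_back_idx j m (y : idx (updim I j m)) i i' :
  setj (back_idx y i) i' = back_idx y i'.
Proof.
apply/ffunP => k; have [->|nk] := eqVneq k j.
  by rewrite setj_eq back_idx_eq.
by rewrite setj_neq // /back_idx !ffunE; case: eqP nk.
Qed.

Lemma fwd_idxK j m x (r : 'I_m) : back_idx (fwd_idx j x r) (x j) = x.
Proof.
apply/ffunP => k; have [->|nk] := eqVneq k j; first by rewrite back_idx_eq.
apply: val_inj; rewrite /back_idx ffunE; case: eqP nk => //= ne _.
by rewrite /fwd_idx ffunE; case: eqP.
Qed.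

Lemma back_idxK j m (y : idx (updim I j m)) i :
  fwd_idx j (back_idx y i) (cast_ord (updim_j I j m) (y j)) = y.
Proof.
apply/ffunP => k; apply: val_inj; have [->|nk] := eqVneq k j.
  by rewrite /fwd_idx ffunE; case: eqP.
rewrite /fwd_idx ffunE; case: eqP nk => //= ne _.
by rewrite /back_idx ffunE; case: eqP.
Qed.

Lemma sum_back_idx (M : nmodType) j m (G : idx I -> 'I_m -> M) :
  \sum_(y : idx (updim I j m)) \sum_(i < I j)
     G (back_idx y i) (cast_ord (updim_j I j m) (y j)) =
  \sum_x \sum_r G x r.
Proof.
rewrite !pair_big.
pose h (p : idx (updim I j m) * 'I_(I j)) :=
  (back_idx p.1 p.2, cast_ord (updim_j I j m) (p.1 j)).
rewrite [RHS](reindex h) //; apply: onW_bij.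
exists (fun p : idx I * 'I_m => (fwd_idx j p.1 p.2, p.1 j)) => -[a b] /=.
  by rewrite back_idxK back_idx_eq.
by rewrite /h /= fwd_idxK fwd_idx_eq.
Qed.

Lemma bigA_distr_idx (R : comPzRingType) (F : forall k, 'I_(I k) -> R) :
  \prod_k \sum_i F k i = \sum_(x : idx I) \prod_k F k (x k).
Proof.
rewrite (reindex (@dffun_of_fprod _ (fun k => 'I_(I k)))); last first.
  exact/onW_bij/dffun_of_fprod_bij.
(* Elements of [fprod] are functions into the tagged union of the ['I_(I k)], so the non-dependent
   distributivity [bigA_distr_big_dep] applies to them. *)
pose G k := [ffun i => F k i].
transitivity (\sum_(t : fprod (fun k => 'I_(I k))) \prod_k G k (t k));
  last first.
  by apply: eq_bigr => t _; apply: eq_bigr => k _; rewrite !ffunE.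
rewrite big_fprod.
transitivity (\prod_k \sum_(i in tagged_with (fun k => 'I_(I k)) k)
                untag 0 (G k) i); last exact: bigA_distr_big_dep.
apply: eq_bigr => k _; rewrite -(big_tag (fun k => G k) k).
by apply: eq_bigr => i _; rewrite ffunE.
Qed.

End Indices.

Lemma sum_enum_val (M : nmodType) (T : finType) (F : T -> M) :
  \sum_(r < #|T|) F (enum_val r) = \sum_x F x.
Proof. by rewrite -big_enum_val. Qed.

(** * Square matrices acting on one mode *)

Section ModeAction.
Variables (K : fieldType) (l : nat) (I : 'I_l -> nat).
Implicit Types (A B : tensor K I) (j k : 'I_l).

(** The mode product by a square matrix, typed in [tensor K I] rather than over [updim I j (I j)],
    so that actions can be iterated and compared with [A]. *)
Definition modeact A j (T : 'M[K]_(I j)) : tensor K I :=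
  fun x => \sum_i T (x j) i * A (setj x i).

Lemma eq_fibers_mx A B j : A =1 B -> fibers_mx A j = fibers_mx B j.
Proof. by move=> AB; apply/matrixP => x i; rewrite !mxE AB. Qed.

Lemma fibers_mx_sub A B j :
  fibers_mx (tsub A B) j = fibers_mx A j - fibers_mx B j.
Proof. by apply/matrixP => x i; rewrite !mxE. Qed.

Lemma fibers_modeact A j (T : 'M[K]_(I j)) :
  fibers_mx (modeact A T) j = fibers_mx A j *m T^T.
Proof.
apply/matrixP => x i; rewrite !mxE; apply: eq_bigr => i' _.
by rewrite !mxE setj_eq setj_setj mulrC.
Qed.

Lemma modeactK A j (S T : 'M[K]_(I j)) :
  S *m T = 1%:M -> modeact (modeact A T) S =1 A.
Proof.
move=> ST x; rewrite /modeact.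
under eq_bigr => i _ do rewrite mulr_sumr.
rewrite exchange_big /= -[in RHS](setj_id x j) (bigD1 (x j)) //=.
rewrite [X in _ + X]big1 ?addr0 => [|i' ne].
  under eq_bigr => i _ do rewrite setj_eq setj_setj setj_id mulrA.
  rewrite -mulr_suml; move/matrixP/(_ (x j) (x j)): ST; rewrite !mxE eqxx.
  by move=> ->; rewrite mul1r setj_id.
under eq_bigr => i _ do rewrite setj_eq setj_setj mulrA.
rewrite -mulr_suml; move/matrixP/(_ (x j) i'): ST; rewrite !mxE eq_sym.
by rewrite (negPf ne) => ->; rewrite mul0r.
Qed.

(** A mode-[k] fiber of the new tensor is a linear combination, with coefficients from a row of [T],
    of the mode-[k] fibers of [A] through the points [setj x i]. *)
Lemma fibers_modeact_sub A j (T : 'M[K]_(I j)) k : k != j ->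
  (fibers_mx (modeact A T) k <= fibers_mx A k)%MS.
Proof.
move=> nkj; apply/row_subP => x; pose x0 := enum_val x.
have -> : row x (fibers_mx (modeact A T) k) =
    \sum_i T (x0 j) i *: row (enum_rank (setj x0 i)) (fibers_mx A k).
  apply/rowP => i; rewrite summxE !mxE /modeact; apply: eq_bigr => i' _.
  by rewrite !mxE enum_rankK setj_neq 1?eq_sym // (setjC _ _ _ nkj).
by apply: summx_sub => i _; apply: scalemx_sub; apply: row_sub.
Qed.

Lemma fibers_modeact_neq A j (T : 'M[K]_(I j)) k : T \in unitmx -> k != j ->
  (fibers_mx (modeact A T) k :=: fibers_mx A k)%MS.
Proof.
move=> uT nkj; apply/eqmxP; rewrite fibers_modeact_sub //=.
rewrite -(eq_fibers_mx k (modeactK A (mulVmx uT))).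
exact: fibers_modeact_sub.
Qed.

Lemma eq_mlprod (J : 'I_l -> nat) A B (Ms Ns : forall k, 'M[K]_(J k, I k)) :
  A =1 B -> (forall k, Ms k = Ns k) -> mlprod A Ms =1 mlprod B Ns.
Proof.
move=> AB MN y; apply: eq_bigr => x _; rewrite AB.
by congr (_ * _); apply: eq_bigr => k _; rewrite MN.
Qed.

Lemma mlprod_modeact (J : 'I_l -> nat) A j (T : 'M[K]_(I j))
    (Ms : forall k, 'M[K]_(J k, I k)) :
  mlprod (modeact A T) Ms =1 mlprod A (dfwith Ms (Ms j *m T)).
Proof.
move=> y; rewrite /mlprod /modeact; under eq_bigr => x _ do rewrite mulr_sumr.
rewrite (sum_setj (fun x i => \prod_k Ms k (y k) (x k) *
  (T (x j) i * A (setj x i)))).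
apply: eq_bigr => x _; rewrite [in RHS](bigD1 j) //= dfwith_in mxE !mulr_suml.
apply: eq_bigr => i _; rewrite setj_setj setj_id setj_eq mulrA; congr (_ * _).
rewrite (bigD1 j) //= setj_eq mulrAC; congr (_ * _).
by apply: eq_bigr => k nk; rewrite setj_neq // dfwith_out // eq_sym.
Qed.

Lemma mlprod_sub (J : 'I_l -> nat) A B (Ms : forall k, 'M[K]_(J k, I k)) :
  mlprod (tsub A B) Ms =1 tsub (mlprod A Ms) (mlprod B Ms).
Proof.
move=> y; rewrite /tsub /mlprod -sumrB.
by apply: eq_bigr => x _; rewrite mulrBr.
Qed.

End ModeAction.


(** * Conjugation, adjoints, Frobenius norm and unitary matrices, for the real and complex cases at
    once *)

Section ConjugationField.

Variables (K : numFieldType) (conj : {rmorphism K -> K}).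
Hypothesis mul_conj : forall x : K, x * conj x = `|x| ^+ 2.
Hypothesis exists_sqrt :
  forall x : K, 0 <= x -> exists2 y : K, 0 <= y & y ^+ 2 = x.

Local Notation "A ^H" := (adjmx conj A) (at level 8, format "A ^H").

Lemma conj_ge0 x : 0 <= x -> conj x = x.
Proof.
move=> x0; have [->|nx] := eqVneq x 0; first exact: rmorph0.
by apply: (mulfI nx); rewrite mul_conj ger0_norm.
Qed.

(** Multiply by [conj x]: [conj (x * conj x)] is the conjugate of a nonnegative number, hence equals
    [x * conj x]. *)
Lemma conjK x : conj (conj x) = x.
Proof.
have [->|nx] := eqVneq x 0; first by rewrite !rmorph0.
have ncx : conj x != 0 by rewrite fmorph_eq0.
apply: (mulfI ncx); rewrite -rmorphM mul_conj [in LHS]conj_ge0 ?exprn_ge0 //.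
by rewrite -mul_conj mulrC.
Qed.

Lemma fixed_real x : conj x = x -> x \is Num.real.
Proof.
move=> cx; have : x ^+ 2 == `|x| ^+ 2 by rewrite -mul_conj cx.
rewrite eqf_sqr => /orP[] /eqP ->; first exact: normr_real.
by rewrite realN normr_real.
Qed.

Lemma adjmxE m n (A : 'M[K]_(m, n)) i j : A^H i j = conj (A j i).
Proof. by rewrite !mxE. Qed.

Lemma adjmxK m n (A : 'M[K]_(m, n)) : A^H^H = A.
Proof. by apply/matrixP=> i j; rewrite !adjmxE conjK. Qed.

Lemma adjmxM m n p (A : 'M[K]_(m, n)) (B : 'M[K]_(n, p)) :
  (A *m B)^H = B^H *m A^H.
Proof. by rewrite /adjmx trmx_mul map_mxM. Qed.

Lemma adjmxB m n (A B : 'M[K]_(m, n)) : (A - B)^H = A^H - B^H.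
Proof. by rewrite /adjmx linearB map_mxB. Qed.

Lemma adjmxZ m n c (A : 'M[K]_(m, n)) : (c *: A)^H = conj c *: A^H.
Proof. by rewrite /adjmx linearZ map_mxZ. Qed.

Lemma adjmx1 n : (1%:M : 'M[K]_n)^H = 1%:M.
Proof. by rewrite /adjmx trmx1 map_mx1. Qed.

Lemma adjmx_scalar c : (c%:M : 'M[K]_1)^H = (conj c)%:M.
Proof. by rewrite /adjmx tr_scalar_mx map_scalar_mx. Qed.

Definition frob2 m n (A : 'M[K]_(m, n)) : K := \tr (A *m A^H).

Lemma frob2E m n (A : 'M[K]_(m, n)) : frob2 A = \sum_i \sum_j `|A i j| ^+ 2.
Proof.
by apply: eq_bigr => i _; rewrite !mxE; apply: eq_bigr => j _;
  rewrite adjmxE mul_conj.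
Qed.

Lemma frob2_ge0 m n (A : 'M[K]_(m, n)) : 0 <= frob2 A.
Proof.
by rewrite frob2E; do 2![apply: sumr_ge0 => ? _]; rewrite exprn_ge0.
Qed.

Lemma frob2_eq0 m n (A : 'M[K]_(m, n)) : (frob2 A == 0) = (A == 0).
Proof.
apply/eqP/eqP=> [|->]; last by rewrite /frob2 mul0mx mxtrace0.
rewrite frob2E => /eqP; rewrite psumr_eq0 => [/allP h|i _]; last first.
  by apply: sumr_ge0 => ? _; rewrite exprn_ge0.
apply/matrixP => i j; have := h i (mem_index_enum _).
rewrite /= psumr_eq0 => [/allP/(_ j (mem_index_enum _))|? _].
  by rewrite /= sqrf_eq0 normr_eq0 mxE => /eqP.
by rewrite exprn_ge0.
Qed.

Lemma frob2_row n (x : 'rV[K]_n) : x *m x^H = (frob2 x)%:M.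
Proof. by rewrite [LHS]mx11_scalar /frob2 /mxtrace big_ord1. Qed.

Lemma mxtrace_adj n (A : 'M[K]_n) : \tr A^H = conj (\tr A).
Proof. by rewrite rmorph_sum; apply: eq_bigr => i _; rewrite adjmxE. Qed.

Lemma frob2B m n (A B : 'M[K]_(m, n)) :
  frob2 (A - B) =
  frob2 A + frob2 B - (\tr (A *m B^H) + conj (\tr (A *m B^H))).
Proof.
rewrite -mxtrace_adj adjmxM adjmxK /frob2 adjmxB mulmxBl !mulmxBr.
by rewrite !raddfB /= opprK [- \tr _ + _]addrC addrACA opprD.
Qed.

Definition unitary n (T : 'M[K]_n) : Prop := T *m T^H = 1%:M.

Lemma unitary1 n : unitary (1%:M : 'M[K]_n).
Proof. by rewrite /unitary adjmx1 mulmx1. Qed.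

Lemma unitaryM n (S T : 'M[K]_n) : unitary S -> unitary T -> unitary (S *m T).
Proof.
by rewrite /unitary adjmxM => uS uT; rewrite -mulmxA (mulmxA T) uT mul1mx.
Qed.

Lemma unitary_adj n (T : 'M[K]_n) : unitary T -> unitary T^H.
Proof. by rewrite /unitary adjmxK; apply: mulmx1C. Qed.

Lemma orthonormal_cols_tr m n (A : 'M[K]_(m, n)) :
  A *m A^H = 1%:M -> orthonormal_cols conj A^T.
Proof.
by move/(congr1 trmx); rewrite trmx_mul trmx1 /orthonormal_cols /adjmx map_trmx.
Qed.

Lemma unitary_tr n (T : 'M[K]_n) : unitary T -> unitary T^T.
Proof. by move/orthonormal_cols_tr/mulmx1C. Qed.

Lemma frob2_unitary m n (A : 'M[K]_(m, n)) T :
  unitary T -> frob2 (A *m T) = frob2 A.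
Proof. by move=> uT; rewrite /frob2 adjmxM mulmxA -(mulmxA A) uT mulmx1. Qed.

(** Pythagoras: for the orthogonal projection [P = V *m V^H], the difference of the two sides is
    [frob2 (A - A *m P)]. *)
Lemma frob2_orthonormal_cols m n p (A : 'M[K]_(m, n)) (V : 'M[K]_(n, p)) :
  orthonormal_cols conj V -> frob2 (A *m V) <= frob2 A.
Proof.
move=> oV; have [P PE] : exists P, P = V *m V^H by eexists.
have PP : P *m P = P by rewrite PE mulmxA -(mulmxA V) oV mulmx1.
have PH : P^H = P by rewrite PE adjmxM adjmxK.
rewrite -subr_ge0; suff -> : frob2 A - frob2 (A *m V) = frob2 (A - A *m P).
  exact: frob2_ge0.
rewrite /frob2 adjmxB (adjmxM A P) PH mulmxBl !mulmxBr !mulmxA -(mulmxA A P P) PP.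
by rewrite subrr subr0 raddfB /= PE adjmxM !mulmxA.
Qed.

(** * Reflections, and alignment of row spaces by a unitary *)

Lemma exists_orthogonal_row m p n (N : 'M[K]_(m, n)) (S : 'M[K]_(p, n)) :
  (\rank S < \rank N)%N ->
  exists x : 'rV[K]_n, [/\ (x <= N)%MS, S *m x^H = 0 & x *m x^H = 1%:M].
Proof.
(* Dimension count: [S^H] maps the row space of [N] into a space of dimension at most [\rank S], so
   it kills a nonzero vector there. That vector is then normalized. *)
move=> ltSN; have : (N :&: kermx S^H)%MS != 0.
  rewrite -mxrank_eq0 -lt0n -(ltn_add2l (\rank (N *m S^H))) addn0.
  rewrite mxrank_mul_ker; apply: leq_ltn_trans ltSN.
  apply: leq_trans (mxrankM_maxr _ _) _.
  by rewrite /adjmx mxrank_map mxrank_tr.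
case/rowV0Pn => x; rewrite sub_capmx => /andP[xN /sub_kermxP xS] nx.
have fx : 0 < frob2 x by rewrite lt_def frob2_eq0 nx frob2_ge0.
have [r r0 rE] := exists_sqrt (ltW fx).
have nr : r != 0 by rewrite -sqrf_eq0 rE gt_eqF.
exists (r^-1 *: x); split; first exact: scalemx_sub.
  by rewrite -[S]adjmxK -adjmxM -scalemxAl xS scaler0 /adjmx trmx0 map_mx0.
rewrite adjmxZ -scalemxAl -scalemxAr frob2_row scalerA conj_ge0 ?invr_ge0 //.
by rewrite scale_scalar_mx -rE expr2 mulrACA mulVf // mulr1.
Qed.

(* The reflection exchanging the unit vectors y and e x; when e x = y the
   coefficient is 0^-1 = 0 and the matrix is the identity. *)
Definition swap_mx n (x y : 'rV[K]_n) (e g : K) : 'M[K]_n :=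
  1%:M - (1 - e * g)^-1 *: ((x - e *: y)^H *m (x - e *: y)).

Section Swap.
Variables (n : nat) (x y : 'rV[K]_n) (e g : K).
Hypotheses (x1 : x *m x^H = 1%:M) (y1 : y *m y^H = 1%:M).
Hypotheses (yx : y *m x^H = g%:M) (cg : conj g = g).
Hypotheses (ee : e * e = 1) (ce : conj e = e).
Local Notation d := (1 - e * g).
Local Notation w := (x - e *: y).
Local Notation T := (swap_mx x y e g).

Let xy : x *m y^H = g%:M.
Proof. by rewrite -[x]adjmxK -adjmxM yx adjmx_scalar cg. Qed.

(** The squared length of [w] is [2 d], so the coefficient [d^-1] in [swap_mx] is the Householder
    coefficient 2 / |w|^2. *)
Let ww : w *m w^H = (d + d)%:M.
Proof.
rewrite adjmxB adjmxZ ce mulmxBl !mulmxBr -!scalemxAl -!scalemxAr x1 y1 xy yx.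
rewrite scalerA ee scale1r scale_scalar_mx -!raddfB /=.
by congr (_%:M); rewrite opprB addrC addrA.
Qed.

Let cd : conj d = d.
Proof. by rewrite rmorphB rmorphM rmorph1 ce cg. Qed.

Lemma swap_coef_ge0 : 0 <= d.
Proof.
have := frob2_ge0 w; rewrite /frob2 ww mxtrace_scalar mulr1n.
by rewrite -mulr2n pmulrn_lge0.
Qed.

Let w0 : d = 0 -> w = 0.
Proof.
by move=> d0; apply/eqP; rewrite -frob2_eq0 /frob2 ww d0 addr0 mxtrace_scalar.
Qed.

Lemma swap_adj : T^H = T.
Proof. by rewrite adjmxB adjmx1 adjmxZ fmorphV cd adjmxM adjmxK. Qed.

Lemma swap_unitary : unitary T.
Proof.
rewrite /unitary swap_adj.
have [d0|nd] := eqVneq d 0.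
  by rewrite /swap_mx w0 // mulmx0 scaler0 subr0 mulmx1.
have : w^H *m w *m (w^H *m w) = (d + d) *: (w^H *m w).
  by rewrite mulmxA -(mulmxA _ w) ww mul_mx_scalar -scalemxAl.
rewrite /swap_mx; move: (w^H *m w) => P PP.
rewrite mulmxBl !mulmxBr !mulmx1 mul1mx -scalemxAl -scalemxAr PP !scalerA.
by rewrite -mulrA mulrDr mulVf // mulrDr mulr1 scalerDl opprB addrK subrK.
Qed.

Lemma swap_yE : y *m T = e *: x.
Proof.
have yw : y *m w^H = (- (e * d))%:M.
  rewrite adjmxB adjmxZ ce mulmxBr -scalemxAr y1 yx scale_scalar_mx -raddfB /=.
  by congr (_%:M); rewrite mulrBr mulr1 mulrA ee mul1r opprB.
rewrite /swap_mx mulmxBr mulmx1 -scalemxAr mulmxA yw mul_scalar_mx scalerA.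
have [d0|nd] := eqVneq d 0.
  have /eqP := w0 d0; rewrite subr_eq0 => /eqP->.
  by rewrite scalerA ee scale1r subrr scaler0 subr0.
by rewrite mulrN mulrCA mulVf // mulr1 scaleNr opprK scalerBr scalerA ee scale1r
   addrC subrK.
Qed.

Lemma swap_xE : x *m T = e *: y.
Proof.
have xE : x = e *: (y *m T) by rewrite swap_yE scalerA ee scale1r.
have := swap_unitary; rewrite /unitary swap_adj => TT.
by rewrite {1}xE -scalemxAl -mulmxA TT mulmx1.
Qed.

Lemma swap_orthogonal m (B : 'M[K]_(m, n)) :
  B *m y^H = 0 -> B *m T *m x^H = 0.
Proof.
by move=> By; rewrite -mulmxA -swap_adj -adjmxM swap_xE adjmxZ -scalemxAr
   By scaler0.
Qed.

(** Of [w = x - e *: y], [A] sees only the [y] part and [B] only the [x] part, so the rank-one term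
    of the reflection leaves a single product. Although [d] depends on [e], it is nonnegative, so
    [e] alone controls the sign of the factor. *)
Lemma swap_gain m (A B : 'M[K]_(m, n)) : A *m x^H = 0 -> B *m y^H = 0 ->
  \tr (A *m (B *m T)^H) =
  \tr (A *m B^H) + d^-1 * e * \tr (A *m y^H *m (B *m x^H)^H).
Proof.
move=> Ax By.
have Aw : A *m w^H = - e *: (A *m y^H).
  by rewrite adjmxB adjmxZ ce mulmxBr -scalemxAr Ax sub0r scaleNr.
have wB : w *m B^H = (B *m x^H)^H.
  by rewrite -[w]adjmxK -adjmxM adjmxB adjmxZ mulmxBr -scalemxAr By
    scaler0 subr0.
rewrite adjmxM swap_adj /swap_mx mulmxBl mul1mx mulmxBr raddfB /=.
congr (_ + _); rewrite -scalemxAl -scalemxAr mxtraceZ -mulrA -mulrN.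
congr (_ * _); rewrite -(mulmxA w^H) wB mulmxA Aw -scalemxAl mxtraceZ.
by rewrite mulNr opprK.
Qed.

End Swap.

(** A reflection can exchange two unit vectors up to sign only if their inner product is real; a
    phase factor on [x] achieves this. *)
Lemma align_phase n (x y : 'rV[K]_n) : exists c g : K,
  [/\ c * conj c = 1, y *m (c *: x)^H = g%:M & conj g = g].
Proof.
have [g yxE] : exists g : K, y *m x^H = g%:M.
  by exists ((y *m x^H) 0 0); rewrite [LHS]mx11_scalar.
have [g0|ng] := eqVneq g 0.
  by exists 1, 0; split; rewrite ?scale1r ?yxE ?g0 ?(rmorph0 conj)
    ?(rmorph1 conj) ?mulr1.
have cn : conj `|g| = `|g| by apply: conj_ge0.
have nn : `|g| != 0 by rewrite normr_eq0.
exists (g / `|g|), `|g|; split=> //.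
  rewrite rmorphM fmorphV cn mulrACA mul_conj expr2 -invfM.
  by rewrite mulfV // mulf_neq0.
rewrite adjmxZ -scalemxAr yxE scale_scalar_mx rmorphM fmorphV cn.
by congr (_%:M); rewrite mulrAC [conj _ * _]mulrC mul_conj expr2 mulfK.
Qed.

(* Induction on dim (S + B). If B is not contained in S, there are unit vectors
   x, y in N = S + B with x orthogonal to S and y orthogonal to B. A reflection
   taking y to e x, e = 1 or -1, moves B into the orthogonal of x in N, and the
   change of the distance to A is linear in e, so one of the two signs does not
   increase it. *)
Lemma unitary_alignment m p n (A B : 'M[K]_(m, n)) (S : 'M[K]_(p, n)) :
  (A <= S)%MS -> (\rank B <= \rank S)%N ->
  exists T : 'M[K]_n,
    [/\ unitary T, (B *m T <= S)%MS & frob2 (A - B *m T) <= frob2 (A - B)].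
Proof.
move=> AS; have [k] := ubnP (\rank (S + B)%MS); elim: k B => // k IH B.
rewrite ltnS => ltk rBS; have [BS|nBS] := boolP (B <= S)%MS.
  by exists 1%:M; rewrite mulmx1; split=> //; apply: unitary1.
pose N := (S + B)%MS; have ltSN : (\rank S < \rank N)%N.
  by rewrite (ltn_leqif (mxrank_leqif_sup (addsmxSl S B))) addsmx_sub submx_refl.
have [x0 [x0N Sx0 x01]] := exists_orthogonal_row ltSN.
have [y [yN By y1]] := exists_orthogonal_row (leq_ltn_trans rBS ltSN).
have [c [g [cc yx cg]]] := align_phase x0 y.
pose x := c *: x0; rewrite -/x in yx.
have xN : (x <= N)%MS by apply: scalemx_sub.
have Sx : S *m x^H = 0 by rewrite adjmxZ -scalemxAr Sx0 scaler0.
have x1 : x *m x^H = 1%:M.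
  by rewrite adjmxZ -scalemxAl -scalemxAr scalerA cc scale1r.
have Ax : A *m x^H = 0 by have /submxP[D ->] := AS; rewrite -mulmxA Sx mulmx0.
pose s := \tr (A *m y^H *m (B *m x^H)^H).
have sR : s + conj s \is Num.real.
  by apply: fixed_real; rewrite rmorphD conjK addrC.
(* [e] is the sign of twice the real part of [s], so the reflection does not decrease the real part
   of the inner product of [A] and [B]. *)
have [e [ee ce es]] : exists e : K,
    [/\ e * e = 1, conj e = e & 0 <= e * (s + conj s)].
  case/orP: sR => h; [exists 1 | exists (-1)].
    by rewrite rmorph1 !mul1r.
  by rewrite rmorphN rmorph1 mulrNN mulr1 mulN1r oppr_ge0.
pose T := swap_mx x y e g; pose d := 1 - e * g.
have uT : unitary T by apply: swap_unitary.
have d0 : 0 <= d by apply: (swap_coef_ge0 x1 y1 yx).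
have gain : frob2 (A - B *m T) <= frob2 (A - B).
  rewrite !frob2B (frob2_unitary _ uT) lerD2l lerN2 (swap_gain cg ce Ax By).
  rewrite -/s -/d.
  rewrite rmorphD rmorphM [conj (_ * e)]rmorphM fmorphV ce (conj_ge0 d0).
  by rewrite addrACA lerDl -mulrDr -mulrA mulr_ge0 ?invr_ge0.
have BTx : B *m T *m x^H = 0 by apply: swap_orthogonal.
have BTN : (B *m T <= N)%MS.
  rewrite /T /swap_mx mulmxBr mulmx1 addmx_sub ?addsmxSr // eqmx_opp.
  rewrite -scalemxAr mulmxA scalemx_sub // mulmx_sub // addmx_sub // eqmx_opp.
  exact: scalemx_sub.
(* The dimension drops because [x] lies in [N] but is a unit vector orthogonal to both [S] and
   [B *m T]. *)
have ltN : (\rank (S + B *m T)%MS < \rank N)%N.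
  have sN : (S + B *m T <= N)%MS by rewrite addsmx_sub addsmxSl.
  rewrite (ltn_leqif (mxrank_leqif_sup sN)); apply/negP => Nle.
  have /sub_kermxP xx : (x <= kermx x^H)%MS.
    apply: submx_trans xN (submx_trans Nle _).
    by rewrite addsmx_sub; apply/andP; split; apply/sub_kermxP.
  by move/matrixP/(_ 0 0): xx; rewrite x1 !mxE; apply/eqP; rewrite oner_eq0.
have [] := IH (B *m T) (leq_trans ltN ltk).
  exact: leq_trans (mxrankM_maxl _ _) rBS.
move=> T' [uT' sT' leT']; exists (T *m T'); rewrite mulmxA; split=> //.
  exact: unitaryM.
exact: le_trans leT' gain.
Qed.

(** Alignment with [A = 0] gives a unitary [T] carrying the row space of [N] onto the span of the
    first [r] coordinate vectors; pulling these back by [T^H] gives the basis. *)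
Lemma exists_orthonormal_basis m n r (N : 'M[K]_(m, n)) : \rank N = r ->
  exists2 V : 'M[K]_(n, r), orthonormal_cols conj V & (V^T :=: N)%MS.
Proof.
move=> rN; have rn : (r <= n)%N by rewrite -rN rank_leq_col.
pose S : 'M[K]_(r, n) := pid_mx r.
have rS : \rank S = r by rewrite rank_pid_mx.
have SS : S *m S^H = 1%:M.
  by rewrite /adjmx tr_pid_mx map_pid_mx pid_mx_id // pid_mx_1.
have [||T [uT sT _]] := @unitary_alignment _ _ _ (0 : 'M_(m, n)) N S.
- exact: sub0mx.
- by rewrite rN rS.
have uT' := mulmx1C uT.
have fT : row_free T by rewrite row_free_unit; case/mulmx1_unit: uT.
exists (S *m T^H)^T.
  apply: orthonormal_cols_tr.
  by rewrite adjmxM adjmxK mulmxA -(mulmxA S) uT' mulmx1.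
rewrite trmxK; apply: (eqmxMfree fT); rewrite -mulmxA uT' mulmx1.
by apply/eqmx_sym/eqmxP; rewrite -(mxrank_leqif_eq sT) mxrankMfree // rN rS.
Qed.

(** * Frobenius norms of tensors under mode products and compressions *)

Section Tensors.
Variables (l : nat) (I : 'I_l -> nat).
Implicit Types (A B : tensor K I) (j k : 'I_l).

Lemma eq_fnorm2 (J : 'I_l -> nat) (A B : tensor K J) :
  A =1 B -> fnorm2 A = fnorm2 B.
Proof. by move=> AB; apply: eq_bigr => x _; rewrite AB. Qed.

(* Each mode-j fiber occurs I j times among the rows of fibers_mx. *)
Lemma frob2_fibers A j : frob2 (fibers_mx A j) = fnorm2 A *+ I j.
Proof.
rewrite frob2E //.
under eq_bigr => r _ do under eq_bigr => i _ do rewrite mxE.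
rewrite (sum_enum_val (fun x => \sum_(i < I j) `|A (setj x i)| ^+ 2)).
rewrite -(sum_setj (fun x (_ : 'I_(I j)) => `|A x| ^+ 2)).
by rewrite -sumrMnl; apply: eq_bigr => x _; rewrite sumr_const card_ord.
Qed.

(** The multiplicity is that of [frob2_fibers]: the entry of the mode product at [y] occurs once for
    each [i], in the row of [back_idx y i]. *)
Lemma frob2_modeprod j m A B (M N : 'M[K]_(m, I j)) :
  frob2 (fibers_mx A j *m M^T - fibers_mx B j *m N^T) =
  fnorm2 (tsub (modeprod A M) (modeprod B N)) *+ I j.
Proof.
pose G x r := `|\sum_i M r i * A (setj x i) - \sum_i N r i * B (setj x i)| ^+ 2.
transitivity (\sum_x \sum_r G x r).
  rewrite frob2E // -[RHS]sum_enum_val.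
  apply: eq_bigr => x _; apply: eq_bigr => r _; rewrite !mxE.
  by congr (`|_ - _| ^+ 2); apply: eq_bigr => i _; rewrite !mxE mulrC.
rewrite -(sum_back_idx j) -sumrMnl; apply: eq_bigr => y _.
rewrite -[I j in RHS]card_ord -sumr_const; apply: eq_bigr => i _.
rewrite /G /tsub /modeprod.
by congr (`|_ - _| ^+ 2); apply: eq_bigr => i' _; rewrite setj_back_idx.
Qed.

Lemma fnorm2_le_mul (J J' : 'I_l -> nat) j (A : tensor K J) (B : tensor K J') :
  (0 < I j)%N -> fnorm2 A *+ I j <= fnorm2 B *+ I j -> fnorm2 A <= fnorm2 B.
Proof. by move=> Ij; rewrite lerMn2r eqn0Ngt Ij. Qed.

Lemma orthonormal_cols_conj n p (V : 'M[K]_(n, p)) :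
  orthonormal_cols conj V -> orthonormal_cols conj (map_mx conj V).
Proof.
rewrite /orthonormal_cols => /(congr1 (map_mx conj)).
by rewrite map_mxM map_mx1 /adjmx map_trmx.
Qed.


(** Flattening [A] to a row vector turns the product in all modes into one multiplication by [Q],
    the Kronecker product of the conjugates of the [Vs k], which again has orthonormal columns. *)
Lemma fnorm2_mlprod (J : 'I_l -> nat) (Vs : forall k, 'M[K]_(I k, J k)) A :
  (forall k, orthonormal_cols conj (Vs k)) ->
  fnorm2 (mlprod A (fun k => (Vs k)^H)) <= fnorm2 A.
Proof.
move=> oV.
pose a : 'rV[K]_(#|{: idx I}|) := \row_x A (enum_val x).
pose q (x : idx I) (y : idx J) := \prod_k conj (Vs k (x k) (y k)).
pose Q : 'M[K]_(#|{: idx I}|, #|{: idx J}|) :=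
  \matrix_(x, y) q (enum_val x) (enum_val y).
(* The sum over [x] factors into a product over the modes of entries of [(Vs k)^H *m Vs k]. *)
have qq (y y' : idx J) : \sum_x conj (q x y) * q x y' = (y == y')%:R.
  transitivity (\sum_(x : idx I) \prod_k
    (Vs k (x k) (y k) * conj (Vs k (x k) (y' k)))).
    apply: eq_bigr => x _; rewrite rmorph_prod -big_split.
    by apply: eq_bigr => k _; rewrite /= conjK.
  rewrite -(bigA_distr_idx (fun k i => Vs k i (y k) * conj (Vs k i (y' k)))).
  transitivity (\prod_k ((y k == y' k)%:R : K)).
    apply: eq_bigr => k _; move/matrixP/(_ (y' k) (y k)): (oV k).
    rewrite !mxE eq_sym => <-; apply: eq_bigr => i _.
    by rewrite adjmxE mulrC.
  have [->|ne] := eqVneq y y'; first by rewrite big1 // => k _; rewrite eqxx.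
  have [k nk] : exists k, y k != y' k.
    apply/existsP; apply: contraNT ne; rewrite negb_exists => /forallP h.
    by apply/eqP/ffunP => k; apply/eqP; have := h k; rewrite negbK.
  by rewrite (bigD1 k) //= (negPf nk) mul0r.
have oQ : orthonormal_cols conj Q.
  apply/matrixP => y y'; rewrite !mxE -(inj_eq enum_val_inj) -qq -[RHS]sum_enum_val.
  by apply: eq_bigr => x _; rewrite adjmxE !mxE.
have := frob2_orthonormal_cols a oQ.
rewrite !frob2E // !big_ord1.
have -> : \sum_j `|a 0 j| ^+ 2 = fnorm2 A.
  rewrite -[RHS]sum_enum_val.
  by apply: eq_bigr => x _; rewrite mxE.
congr (_ <= _); rewrite -[RHS]sum_enum_val.
apply: eq_bigr => y _; congr (`|_| ^+ 2); rewrite mxE /mlprod.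
rewrite -[RHS]sum_enum_val; apply: eq_bigr => x _.
rewrite !mxE mulrC; congr (_ * _); apply: eq_bigr => k _.
by rewrite adjmxE.
Qed.

Lemma frob2_distC m n (A B : 'M[K]_(m, n)) : frob2 (A - B) = frob2 (B - A).
Proof.
rewrite !frob2E //; do 2![apply: eq_bigr => ? _].
by rewrite !mxE distrC.
Qed.

Lemma rank_orthonormal_cols n p (V : 'M[K]_(n, p)) :
  orthonormal_cols conj V -> \rank V = p.
Proof.
move=> oV; apply/eqP; rewrite eqn_leq rank_leq_col /= -{1}[p](mxrank1 K) -oV.
exact: mxrankM_maxr.
Qed.

Lemma unitary_unitmx n (T : 'M[K]_n) : unitary T -> T \in unitmx.
Proof. by case/mulmx1_unit. Qed.

Lemma unitary_orthonormal_cols n p (T : 'M[K]_n) (V : 'M[K]_(n, p)) :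
  unitary T -> orthonormal_cols conj V -> orthonormal_cols conj (T^H *m V).
Proof.
move=> uT oV; rewrite /orthonormal_cols adjmxM adjmxK.
by rewrite mulmxA -(mulmxA _ T) uT mulmx1.
Qed.

Lemma fnorm2_ge0 (J : 'I_l -> nat) (A : tensor K J) : 0 <= fnorm2 A.
Proof. by apply: sumr_ge0 => x _; rewrite exprn_ge0. Qed.

Lemma fnorm2_dim0 A j : I j = 0%N -> fnorm2 A = 0.
Proof.
by move=> Ij; apply: big1 => x _; have := ltn_ord (x j); rewrite {2}Ij.
Qed.

Lemma orth_mode_compression j r (V : 'M[K]_(I j, r)) A B :
  orthonormal_cols conj V -> (fibers_mx A j <= V^T)%MS -> (mlrank B j <= r)%N ->
  exists Vh : 'M[K]_(I j, r),
    [/\ orthonormal_cols conj Vh, (fibers_mx B j <= Vh^T)%MS &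
        fnorm2 (tsub (modeprod A V^H) (modeprod B Vh^H)) <= fnorm2 (tsub A B)].
Proof.
move=> oV AV rB; have rV : \rank V^T = r.
  by rewrite mxrank_tr rank_orthonormal_cols.
have [|T [uT sT leT]] := unitary_alignment AV (B := fibers_mx B j).
  by rewrite rV.
have uT' : unitary T^T by apply: unitary_tr.
have TE : T^T^H = map_mx conj T by rewrite /adjmx trmxK.
(* Fibers are rows of [fibers_mx], so right multiplication by [T] acts on a fiber, as a column, by
   [T^T]. *)
exists (T^T^H *m V); split; first exact: unitary_orthonormal_cols.
  rewrite trmx_mul TE map_trmx -[X in (X <= _)%MS]mulmx1 -uT mulmxA.
  exact: submxMr.
(* The multiplicity [I j] can be cancelled only when positive; when it is 0, the sums defining both
   mode products are empty. *)
have [Ij|] := posnP (I j).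
  rewrite [X in X <= _]big1 ?fnorm2_ge0 // => y _; rewrite /tsub /modeprod.
  by rewrite !big1 ?subrr ?normr0 ?expr0n // => i _; have := ltn_ord i; rewrite {2}Ij.
move/fnorm2_le_mul; apply; rewrite -frob2_modeprod.
rewrite -frob2_fibers fibers_mx_sub; apply: le_trans leT.
have -> : ((T^T^H *m V)^H)^T = T *m map_mx conj V.
  by rewrite adjmxM adjmxK trmx_mul trmxK /adjmx map_trmx trmxK.
have -> : (V^H)^T = map_mx conj V by rewrite /adjmx map_trmx trmxK.
rewrite mulmxA -mulmxBl; apply: frob2_orthonormal_cols => //.
exact: orthonormal_cols_conj.
Qed.

(** * Alignment mode by mode and compression in all modes *)

Definition comparable_mx m p n (A : 'M[K]_(m, n)) (B : 'M[K]_(p, n)) :=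
  (A <= B)%MS || (B <= A)%MS.

(** Source of the maximum in the compressed sizes. Writing the larger of two nested spaces as their
    sum avoids a case distinction in each mode. *)
Lemma rank_adds_comparable m p n (A : 'M[K]_(m, n)) (B : 'M[K]_(p, n)) :
  comparable_mx A B -> \rank (A + B)%MS = maxn (\rank A) (\rank B).
Proof.
case/orP => h.
  by rewrite (addsmx_idPr h) (maxn_idPr (mxrankS h)).
by rewrite (addsmx_idPl h) (maxn_idPl (mxrankS h)).
Qed.

Lemma mode_alignment A B j : exists T : 'M[K]_(I j),
  [/\ unitary T, comparable_mx (fibers_mx A j) (fibers_mx (modeact B T) j) &
      fnorm2 (tsub A (modeact B T)) <= fnorm2 (tsub A B)].
Proof.
suff [T [uT cT leT]] : exists T : 'M[K]_(I j),
    [/\ unitary T, comparable_mx (fibers_mx A j) (fibers_mx B j *m T) &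
      frob2 (fibers_mx A j - fibers_mx B j *m T) <=
      frob2 (fibers_mx A j - fibers_mx B j)].
  exists T^T; rewrite fibers_modeact trmxK; split=> //; first exact: unitary_tr.
  have [Ij|] := posnP (I j); first by rewrite !(fnorm2_dim0 _ Ij).
  move/fnorm2_le_mul; apply.
  by rewrite -!frob2_fibers !fibers_mx_sub fibers_modeact trmxK.
case: (leqP (\rank (fibers_mx B j)) (\rank (fibers_mx A j))) => [|/ltnW] rAB.
  have [T [uT sT leT]] :=
    unitary_alignment (submx_refl (fibers_mx A j)) rAB.
  by exists T; split=> //; rewrite /comparable_mx sT orbT.
have [T [uT sT leT]] :=
  unitary_alignment (submx_refl (fibers_mx B j)) rAB.
exists T^H; split; first exact: unitary_adj.
  rewrite /comparable_mx -[X in (X <= _)%MS]mulmx1 -uT mulmxA.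
  by rewrite (submxMr T^H sT).
rewrite -(frob2_unitary _ uT) mulmxBl -mulmxA (mulmx1C uT) mulmx1.
by rewrite [X in X <= _]frob2_distC [X in _ <= X]frob2_distC.
Qed.

(** [B'] is [B] moved by the unitaries [Ts], recorded through its effect on multilinear products and
    on fiber spaces. The mode product identity is quantified over [Ms] so that the induction can
    absorb one more factor. *)
Lemma multimode_alignment A B (s : seq 'I_l) :
  exists (B' : tensor K I) (Ts : forall k, 'M[K]_(I k)),
  [/\ forall k, unitary (Ts k),
      forall (J : 'I_l -> nat) (Ms : forall k, 'M[K]_(J k, I k)),
        mlprod B' Ms =1 mlprod B (fun k => Ms k *m Ts k),
      forall k, (fibers_mx B' k :=: fibers_mx B k *m (Ts k)^T)%MS,
      {in s, forall k, comparable_mx (fibers_mx A k) (fibers_mx B' k)} &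
      fnorm2 (tsub A B') <= fnorm2 (tsub A B)].
Proof.
elim: s => [|j s [B' [Ts [uTs mB' fB' cB' leB']]]].
  exists B, (fun k => 1%:M); split=> // [k|J Ms|k]; first exact: unitary1.
    by apply: eq_mlprod => // k; rewrite mulmx1.
  by rewrite trmx1 mulmx1.
have [T [uT cT leT]] := mode_alignment A B' j.
have fB k : k != j -> (fibers_mx (modeact B' T) k :=: fibers_mx B' k)%MS.
  by move=> nk; apply: fibers_modeact_neq => //; apply: unitary_unitmx.
exists (modeact B' T), (dfwith Ts (T *m Ts j)); split.
- by move=> k; case: dfwithP => // ; apply: unitaryM.
- move=> J Ms y; rewrite mlprod_modeact mB'; apply: eq_mlprod => // k.
  have [<-|nk] := eqVneq j k; first by rewrite !dfwith_in mulmxA.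
  by rewrite !dfwith_out.
- move=> k; have [<-|nk] := eqVneq j k.
    by rewrite dfwith_in fibers_modeact trmx_mul mulmxA; apply: eqmxMr.
  by rewrite dfwith_out //; apply: eqmx_trans (fB' k); apply: fB; rewrite eq_sym.
- move=> k; rewrite inE; have [-> //|nk /= ks] := eqVneq k j.
  by rewrite /comparable_mx !fB //; apply: cB'.
exact: le_trans leT leB'.
Qed.

Lemma orth_compressions_exist A B (Rs : 'I_l -> nat) :
  (forall k, maxn (mlrank A k) (mlrank B k) = Rs k) ->
  exists Ac Bc : tensor K Rs,
    [/\ orth_compression conj A Ac, orth_compression conj B Bc &
        fnorm2 (tsub Ac Bc) <= fnorm2 (tsub A B)].
Proof.
move=> RsE; have [B' [Ts [uTs mB' fB' cB' leB']]] :=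
  multimode_alignment A B (enum 'I_l).
have rB' k : \rank (fibers_mx B' k) = mlrank B k.
  rewrite fB' mxrankMfree // row_free_unit unitmx_tr; exact: unitary_unitmx.
have rN k : \rank (fibers_mx A k + fibers_mx B' k)%MS = Rs k.
  by rewrite rank_adds_comparable ?rB' ?RsE // cB' ?mem_enum.
have [Vs oVs eVs] := fin_all_exists2 (fun k =>
  exists_orthonormal_basis (rN k)).
exists (mlprod A (fun k => (Vs k)^H)),
  (mlprod B (fun k => ((Ts k)^H *m Vs k)^H)); split.
- exists Vs; split=> // k; split; first exact: oVs.
  by rewrite eVs addsmxSl.
- exists (fun k => (Ts k)^H *m Vs k); split=> // k; split.
    exact: unitary_orthonormal_cols.
  rewrite trmx_mul -[X in (X <= _)%MS]mulmx1 -trmx1 -(mulmx1C (uTs k)).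
  by rewrite trmx_mul mulmxA submxMr // -fB' eVs addsmxSr.
apply: le_trans leB'.
apply: le_trans (fnorm2_mlprod (tsub A B') oVs).
(* Compressing [B] by the [(Ts k)^H *m Vs k] is compressing [B'] by the [Vs k], so the difference is
   the compression of [tsub A B'] by a single family. *)
rewrite le_eqVlt; apply/orP; left; apply/eqP/eq_fnorm2 => y.
rewrite mlprod_sub /tsub mB'; congr (_ - _); apply: eq_mlprod => // k.
by rewrite adjmxM adjmxK.
Qed.

End Tensors.

(** * The theorem for a field with conjugation, then for both fields *)

Lemma Thm41_conj : Thm41 conj.
Proof.
move=> l I W Wh R Rh rW rWh; split=> [j V oV eV ltR|].
  by apply: orth_mode_compression => //; [case/andP: eV | rewrite rWh].
by apply: orth_compressions_exist => k; rewrite rW rWh.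
Qed.

End ConjugationField.

(* K = R (real closed field, conjugation = identity) and
   K = C (numeric closed field, complex conjugation). *)
Theorem theorem4p1 :
  (forall R : rcfType, @Thm41 R id) /\
  (forall C : numClosedFieldType, @Thm41 C (@Num.conj C)).
Proof.
split=> [R|C].
  apply: (@Thm41_conj R idfun) => x; first by rewrite real_normK ?num_real ?expr2.
  by move=> x0; exists (Num.sqrt x); rewrite ?sqrtr_ge0 ?sqr_sqrtr.
apply: (@Thm41_conj C Num.conj) => x; first by rewrite normCK.
by move=> x0; exists (sqrtC x); rewrite ?sqrtC_ge0 ?sqrtCK.
Qed.
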